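(* Let $r\ge 1$, let $\mathbf{k}=(k_1,\dots,k_r)\in\mathbb{Z}^r$, let $p$ be an odd prime, and let $m,n,N$ be positive integers with $m,n\ge N$ and $\operatorname{wt}(\mathbf{k}^+)<p-1$. If $m\equiv n \bmod (p-1)p^{N-1}$, then $$p^{2\operatorname{wt}(\mathbf{k}^+)}B_m^{(\mathbf{k})}\equiv p^{2\operatorname{wt}(\mathbf{k}^+)}B_n^{(\mathbf{k})} \bmod p^N$$ and $$p^{2\operatorname{wt}(\mathbf{k}^+)}C_m^{(\mathbf{k})}\equiv p^{2\operatorname{wt}(\mathbf{k}^+)}C_n^{(\mathbf{k})} \bmod p^N.$$
   Context: For $\mathbf{k}=(k_1,\dots,k_r)\in\mathbb{Z}^r$ (an index), put $k_i'=\max\{k_i,0\}$, $\mathbf{k}^+=(k_1',\dots,k_r')$, and $\operatorname{wt}(\mathbf{k})=k_1+\cdots+k_r$, so that $\operatorname{wt}(\mathbf{k}^+)=k_1'+\cdots+k_r'$. The multiple polylogarithm is the formal power series over $\mathbb{Q}$ $$\operatorname{Li}_{\mathbf{k}}(t)=\sum_{0<m_1<\cdots<m_r}\frac{t^{m_r}}{m_1^{k_1}\cdots m_r^{k_r}},$$ the sum being over integers $m_1,\dots,m_r$. The multi-poly-Bernoulli numbers $B_n^{(\mathbf{k})}, C_n^{(\mathbf{k})}\in\mathbb{Q}$ ($n\ge 0$) are defined by the identities of formal power series over $\mathbb{Q}$ $$\frac{\operatorname{Li}_{\mathbf{k}}(1-e^{-t})}{1-e^{-t}}=\sum_{n=0}^\infty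 B_n^{(\mathbf{k})}\frac{t^n}{n!},\qquad \frac{\operatorname{Li}_{\mathbf{k}}(1-e^{-t})}{e^t-1}=\sum_{n=0}^\infty C_n^{(\mathbf{k})}\frac{t^n}{n!}.$$ For rational numbers $a,b$, the congruence $a\equiv b \bmod p^N$ means $p^{-N}(a-b)\in\mathbb{Z}_p$, where $\mathbb{Z}_p$ is the ring of $p$-adic integers (i.e. $a-b$ has $p$-adic valuation at least $N$). *)

(* Defs.v *)
From mathcomp Require Import all_boot all_order all_algebra.

Set Implicit Arguments.
Unset Strict Implicit.
Unset Printing Implicit Defensive.

Import Order.TTheory GRing.Theory Num.Theory.

Local Open Scope ring_scope.

(* A formal power series over Q is its coefficient sequence; equalities between
   series are stated with =1. *)
Definition fps := nat -> rat.

Definition fps_one : fps := fun n => (n == 0)%:R.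

Definition fps_sub (f g : fps) : fps := fun n => f n - g n.

Definition fps_mul (f g : fps) : fps :=
  fun n => \sum_(i < n.+1) f i * g (n - i)%N.

Definition fps_pow (f : fps) (j : nat) : fps := iter j (fps_mul f) fps_one.

(* f(g(t)), meaningful for g 0 = 0: then g ^ j has no term of degree < j, so
   the powers j > n do not contribute to the coefficient of t ^ n. *)
Definition fps_comp (f g : fps) : fps :=
  fun n => \sum_(j < n.+1) f j * fps_pow g j n.

(* f(t) / g(t) by long division, for f 0 = g 0 = 0 and g 1 != 0 (see fps_divK
   and fps_div_uniq): the first n coefficients of the quotient. *)
Fixpoint fps_div_seq (f g : fps) (n : nat) : seq rat :=
  if n is m.+1 then
    let q := fps_div_seq f g m in
    rcons q ((f m.+1 - \sum_(i < m) q`_i * g (m.+1 - i)%N) / g 1%N)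
  else [::].

Definition fps_div (f g : fps) : fps := fun n => (fps_div_seq f g n.+1)`_n.

(* The series e ^ (c t). *)
Definition fps_expc (c : rat) : fps := fun n => c ^+ n / n`!%:R.

Definition fps_egf (a : nat -> rat) : fps := fun n => a n / n`!%:R.

Section Index.

Variable r : nat.
Implicit Type k : r.-tuple int.

Definition wt k : int := \sum_(i < r) tnth k i.

Definition index_pos k : r.-tuple int := [tuple Num.max (tnth k i) 0 | i < r].

(* The coefficient of t ^ n collects the r-tuples 0 < m_1 < ... < m_r = n, whose
   entries all lie in {0, ..., n}. For r = 0 this is the constant series 1. *)
Definition Li k : fps := fun n =>
  \sum_(m : r.-tuple 'I_n.+1 |
          let s := [seq val j | j <- m] in path ltn 0%N s && (last 0%N s == n))
     \prod_(i < r) ((tnth m i : nat)%:R ^ tnth k i)^-1.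

Definition one_sub_expN : fps := fps_sub fps_one (fps_expc (-1)).

Definition exp_sub_one : fps := fps_sub (fps_expc 1) fps_one.

Definition polyBernoulliB k : nat -> rat := fun n =>
  n`!%:R * fps_div (fps_comp (Li k) one_sub_expN) one_sub_expN n.

Definition polyBernoulliC k : nat -> rat := fun n =>
  n`!%:R * fps_div (fps_comp (Li k) one_sub_expN) exp_sub_one n.

End Index.

Definition padic_val (p : nat) (x : rat) : int :=
  (logn p `|numq x|)%:Z - (logn p `|denq x|)%:Z.

(* Membership of a rational number in Z_p. *)
Definition padic_integral (p : nat) (x : rat) : bool :=
  (x == 0) || (0 <= padic_val p x).

Definition padic_congr (p N : nat) (a b : rat) : bool :=
  padic_integral p (p%:R ^- N * (a - b)).

Lemma size_fps_div_seq f g n : size (fps_div_seq f g n) = n.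
Proof. by elim: n => //= n IHn; rewrite size_rcons IHn. Qed.

Lemma nth_fps_div_seq f g n i : (i < n)%N ->
  (fps_div_seq f g n)`_i = fps_div f g i.
Proof.
elim: n => // n IHn; rewrite ltnS leq_eqVlt => /predU1P[-> //|lt_in] /=.
by rewrite nth_rcons size_fps_div_seq lt_in IHn.
Qed.

Lemma fps_divE f g n : fps_div f g n =
  (f n.+1 - \sum_(i < n) fps_div f g i * g (n.+1 - i)%N) / g 1%N.
Proof.
rewrite /fps_div /= nth_rcons size_fps_div_seq ltnn eqxx.
congr ((_ - _) / _); apply: eq_bigr => i _.
by rewrite nth_fps_div_seq.
Qed.

Lemma fps_divK f g : f 0%N = 0 -> g 0%N = 0 -> g 1%N != 0 ->
  fps_mul (fps_div f g) g =1 f.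
Proof.
move=> f0 g0 g1 [|n]; rewrite /fps_mul.
  by rewrite big_ord_recr big_ord0 /= g0 f0 mulr0 addr0.
rewrite !big_ord_recr /= subnn g0 mulr0 addr0 subSnn fps_divE divfK //.
by rewrite addrC subrK.
Qed.

Lemma fps_div_uniq f g q : g 0%N = 0 -> g 1%N != 0 ->
  fps_mul q g =1 f -> q =1 fps_div f g.
Proof.
move=> g0 g1 qg n; elim/ltn_ind: n => n IHn.
rewrite fps_divE -qg /fps_mul !big_ord_recr /= subnn g0 mulr0 addr0 subSnn.
rewrite (eq_bigr (fun i : 'I_n => fps_div f g i * g (n.+1 - i)%N)).
  by rewrite addrAC subrr add0r mulfK.
by move=> i _; rewrite IHn.
Qed.

Lemma one_sub_expN0 : one_sub_expN 0 = 0.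
Proof. by rewrite /one_sub_expN /fps_sub /fps_expc expr0 divr1 subrr. Qed.

Lemma one_sub_expN1 : one_sub_expN 1 = 1.
Proof. by rewrite /one_sub_expN /fps_sub /fps_expc expr1 divr1 sub0r opprK. Qed.

Lemma exp_sub_one0 : exp_sub_one 0 = 0.
Proof. by rewrite /exp_sub_one /fps_sub /fps_expc expr0 divr1 subrr. Qed.

Lemma exp_sub_one1 : exp_sub_one 1 = 1.
Proof. by rewrite /exp_sub_one /fps_sub /fps_expc expr1 divr1 subr0. Qed.

Lemma Li0 r (k : r.-tuple int) : (0 < r)%N -> Li k 0 = 0.
Proof.
move=> r_gt0; rewrite /Li big_pred0 // => -[[|x m] /= /eqP sz].
  by rewrite -sz in r_gt0.
by case: x {sz} => -[].
Qed.

Lemma fps_comp0 f g : fps_comp f g 0 = f 0%N.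
Proof. by rewrite /fps_comp big_ord_recr big_ord0 /= add0r mulr1. Qed.

Lemma fps_egfK (q : fps) : fps_egf (fun n => n`!%:R * q n) =1 q.
Proof.
by move=> n; rewrite /fps_egf mulrC mulKf // pnatr_eq0 -lt0n fact_gt0.
Qed.

Lemma eq_fps_mull f f' g : f =1 f' -> fps_mul f g =1 fps_mul f' g.
Proof. by move=> ff n; apply: eq_bigr => i _; rewrite ff. Qed.

Lemma polyBernoulliB_egf r (k : r.-tuple int) : (0 < r)%N ->
  fps_mul (fps_egf (polyBernoulliB k)) one_sub_expN
    =1 fps_comp (Li k) one_sub_expN.
Proof.
move=> r_gt0 n; rewrite (eq_fps_mull _ (fps_egfK _)).
by rewrite fps_divK ?fps_comp0 ?Li0 ?one_sub_expN0 ?one_sub_expN1 ?oner_eq0.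
Qed.

Lemma polyBernoulliC_egf r (k : r.-tuple int) : (0 < r)%N ->
  fps_mul (fps_egf (polyBernoulliC k)) exp_sub_one
    =1 fps_comp (Li k) one_sub_expN.
Proof.
move=> r_gt0 n; rewrite (eq_fps_mull _ (fps_egfK _)).
by rewrite fps_divK ?fps_comp0 ?Li0 ?exp_sub_one0 ?exp_sub_one1 ?oner_eq0.
Qed.

(* Main.v *)
Require Import Defs.
From mathcomp Require Import all_boot all_order all_algebra.
From mathcomp Require Import cyclic ring zify.

(* Write Li_k(x) as the sum of a_j x^j, and let D be the forward difference.
   Expanding (1 - e^(-t))^j shows that B_n is the sum over j of
   (-1)^(j+n) a_(j+1) (D^j X^n)(0), and C_n is the same sum with D^j X^n
   evaluated at 1. The coefficient a_(j+1) may have the denominator p^(e w) with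
   w = wt(k^+) and p^e <= j+1, which grows with j, so D^j (X^m - X^n) has to be
   more divisible by p than p^N.
   On each residue class, f = X^m - X^n is p^N times an integral polynomial:
   f(j + p X) is in p^N Z[X]. If f(j + p X) is in p^t Z[X] for all j, then the
   same holds for D^(p^2) f with t+1 in place of t: p divides 'C(p^2, s) for
   0 < s < p^2, so that D^(p^2) f is f(X + p^2) - f(X) up to p times translates
   of f, and u(X + p) - u(X) is in p Z[X] for every integral u. Hence
   p^(N + floor(j/p^2)) divides all values of D^j (X^m - X^n) on the naturals, and
   e w <= 2 w + floor(j/p^2) because w < p - 1. *)

Set Implicit Arguments.
Unset Strict Implicit.
Unset Printing Implicit Defensive.

Import Order.TTheory GRing.Theory Num.Theory.

Local Open Scope ring_scope.

(** * Divisibility in a commutative ring *)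

Section Divisibility.

Variable R : comNzRingType.
Implicit Types a b c d : R.

Definition dvdr a b := exists c, b = a * c.

Lemma dvdr0 a : dvdr a 0.
Proof. by exists 0; rewrite mulr0. Qed.

Lemma dvdrD a b c : dvdr a b -> dvdr a c -> dvdr a (b + c).
Proof. by move=> [x ->] [y ->]; exists (x + y); rewrite mulrDr. Qed.

Lemma dvdr_mull a b c : dvdr a b -> dvdr a (c * b).
Proof. by move=> [x ->]; exists (c * x); rewrite mulrCA. Qed.

Lemma dvdrN a b : dvdr a b -> dvdr a (- b).
Proof. by rewrite -mulN1r; apply: dvdr_mull. Qed.

Lemma dvdrB a b c : dvdr a b -> dvdr a c -> dvdr a (b - c).
Proof. by move=> ab ac; apply/dvdrD/dvdrN. Qed.

Lemma dvdr_mul a b c d : dvdr a b -> dvdr c d -> dvdr (a * c) (b * d).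
Proof. by move=> [x ->] [y ->]; exists (x * y); rewrite mulrACA. Qed.

Lemma dvdr_sum a (I : Type) (s : seq I) (F : I -> R) :
  (forall i, dvdr a (F i)) -> dvdr a (\sum_(i <- s) F i).
Proof. by move=> aF; apply: big_ind => //; [apply: dvdr0|apply: dvdrD]. Qed.

Lemma dvdr_exp a b n : dvdr a b -> dvdr (a ^+ n) (b ^+ n).
Proof. by move=> [x ->]; exists (x ^+ n); rewrite exprMn. Qed.

Lemma dvdr_subXX a b c n : dvdr a (b - c) -> dvdr a (b ^+ n - c ^+ n).
Proof. by rewrite subrXX mulrC; apply: dvdr_mull. Qed.

Lemma dvdr_natr (d n : nat) : (d %| n)%N -> dvdr (d%:R : R) n%:R.
Proof. by move=> /dvdnP[k ->]; exists k%:R; rewrite natrM mulrC. Qed.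

(** Passing from the exponent [p ^ n] to [p ^ n.+1] multiplies the difference by a sum of [p] powers
    of [a], each congruent to 1 mod [p]; this sum supplies one more factor [p]. *)
Lemma dvdr_exp_sub1 (p n : nat) a :
  dvdr p%:R (a - 1) -> dvdr (p%:R ^+ n.+1) (a ^+ (p ^ n) - 1).
Proof.
move=> pa; elim: n => [|n IHn]; first by rewrite expr1 expn0 expr1.
rewrite expnSr exprM subrX1 exprSr; apply: dvdr_mul => //.
have -> : \sum_(i < p) (a ^+ (p ^ n)) ^+ i =
          \sum_(i < p) (a ^+ (p ^ n * i) - 1 ^+ (p ^ n * i)) + p%:R.
  rewrite sumrB (eq_bigr _ (fun i _ => esym (exprM _ _ _))).
  under [X in _ - X]eq_bigr do rewrite expr1n.
  by rewrite sumr_const card_ord subrK.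
apply: dvdrD; last by exists 1; rewrite mulr1.
by apply: dvdr_sum => i; apply: dvdr_subXX.
Qed.

End Divisibility.

(** Since [s * 'C(p ^ 2, s) = p ^ 2 * 'C(p ^ 2 - 1, s - 1)], a binomial prime to [p] would force
    [p ^ 2] to divide [s]. *)
Lemma prime_dvd_binX2 (p s : nat) :
  prime p -> (0 < s < p ^ 2)%N -> (p %| 'C(p ^ 2, s))%N.
Proof.
move=> p_pr /andP[s_gt0 s_lt]; apply: contraLR s_lt.
rewrite -prime_coprime // -leqNgt => cop; apply: dvdn_leq => //.
have /(Gauss_dvdl s) <- : coprime (p ^ 2) 'C(p ^ 2, s) by rewrite coprimeXl.
by case: s s_gt0 {cop} => // s _; rewrite -mul_bin_diag dvdn_mulr.
Qed.

(** * Forward differences of integer polynomials *)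

Definition fdiff (f : {poly int}) : {poly int} := f \Po ('X + 1) - f.

Lemma fdiffB f g : fdiff (f - g) = fdiff f - fdiff g.
Proof. by rewrite /fdiff comp_polyB; ring. Qed.

Lemma iter_fdiffB n f g : iter n fdiff (f - g) = iter n fdiff f - iter n fdiff g.
Proof. by elim: n => //= n ->; rewrite fdiffB. Qed.

Lemma horner_fdiff f x : (fdiff f).[x] = f.[x + 1] - f.[x].
Proof. by rewrite hornerD hornerN horner_comp !hornerE. Qed.

Lemma iter_fdiffE n f : iter n fdiff f =
  \sum_(s < n.+1) ((-1) ^+ (n + s) * 'C(n, s)%:R) *: (f \Po ('X + s%:R)).
Proof.
elim: n => [|n IHn]; first by rewrite big_ord1 addr0 comp_polyXr mul1r scale1r.
have shiftE (s : nat) : (f \Po ('X + s%:R)) \Po ('X + 1) = f \Po ('X + s.+1%:R).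
  rewrite -comp_polyA comp_polyD comp_polyX -polyC_natr comp_polyC -addrA.
  by congr (_ \Po (_ + _)); rewrite polyC_natr -natr1 addrC.
(* A vanishing term [s = n.+1] is added so that the two sums line up for Pascal's rule. *)
have IHn' : iter n fdiff f =
    \sum_(s < n.+2) ((-1) ^+ (n + s) * 'C(n, s)%:R) *: (f \Po ('X + s%:R)).
  by rewrite big_ord_recr /= bin_small // mulr0 scale0r addr0.
rewrite iterS /fdiff {1}IHn {}IHn' raddf_sum /=.
rewrite [X in _ - X]big_ord_recl [RHS]big_ord_recl /= !bin0 opprD addrCA.
congr (_ + _); first by rewrite -scaleNr addSn exprS mulN1r mulNr.
rewrite -sumrB; apply: eq_bigr => s _.
rewrite comp_polyZ shiftE -scalerBl /bump /= add1n binS natrD !addnS addSn !exprS.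
by congr (_ *: _); ring.
Qed.

Lemma dvdr_comp_shift (f : {poly int}) (a : int) :
  dvdr a%:P ((f \Po ('X + a%:P)) - f).
Proof.
elim/poly_ind: f => [|f c [g IHf]]; first by rewrite comp_poly0 subrr; apply: dvdr0.
rewrite comp_polyD comp_polyM comp_polyX comp_polyC.
exists (g * 'X + (f \Po ('X + a%:P))).
by move/eqP: IHf; rewrite subr_eq => /eqP ->; ring.
Qed.

(** * Growth of p-divisibility under iterated differences *)

Section PadicDifferences.

Variable p : nat.
Hypothesis p_pr : prime p.

(* f is divisible by p ^ t as a polynomial on every residue class mod p, which is
   stronger than the divisibility of its values. *)
Definition residue_dvd (t : nat) (f : {poly int}) :=
  forall j : nat, dvdr (p%:R ^+ t) (f \Po (p%:R * 'X + j%:R)).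

Lemma residue_dvd_fdiff t f : residue_dvd t f -> residue_dvd t (fdiff f).
Proof.
move=> fP j; rewrite /fdiff comp_polyB -comp_polyA; apply: dvdrB => //.
have -> : ('X + 1) \Po (p%:R * 'X + j%:R) = p%:R * 'X + j.+1%:R :> {poly int}.
  by rewrite comp_polyD comp_polyX -[1]polyC1 comp_polyC polyC1 -addrA natr1.
exact: fP.
Qed.

Lemma residue_dvd_iter_fdiffX2 t f : odd p ->
  residue_dvd t f -> residue_dvd t.+1 (iter (p ^ 2) fdiff f).
Proof.
move=> p_odd fP j; rewrite iter_fdiffE raddf_sum /=.
have compE (s : nat) : (f \Po ('X + s%:R)) \Po (p%:R * 'X + j%:R) =
    f \Po (p%:R * 'X + (j + s)%:R).
  rewrite -comp_polyA comp_polyD comp_polyX -[s%:R in LHS]polyC_natr comp_polyC.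
  by rewrite polyC_natr -addrA natrD.
under eq_bigr do rewrite comp_polyZ compE.
case def_q: (p ^ 2)%N => [|q]; first by move/eqP: def_q; rewrite expn_eq0; case: p p_pr.
(* The terms [s = 0] and [s = p ^ 2] are split off; in every other term the binomial coefficient
   gives the extra factor [p]. *)
rewrite big_ord_recl big_ord_recr /= addrCA; apply: dvdrD.
  apply: dvdr_sum => s; rewrite -mul_polyC exprS; apply: dvdr_mul; last exact: fP.
  rewrite polyCM polyC_natr; apply/dvdr_mull/dvdr_natr.
  by rewrite -def_q prime_dvd_binX2 // def_q /bump /= add1n /= ltnS ltn_ord.
(* As [p] is odd, the two end terms have opposite signs and form a difference. *)
rewrite /bump /= add1n addnn -mul2n mulnC exprM sqrr_sign binn bin0 addn0 -def_q.
rewrite !mulr1 scale1r -signr_odd oddX p_odd orbT expr1 scaleN1r addrC addn0.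
have [u uE] := fP j.
(* After the substitution [p X + j], a shift by [p ^ 2] is a shift of [X] by [p]. *)
have -> : f \Po (p%:R * 'X + (j + p ^ 2)%:R) =
    (f \Po (p%:R * 'X + j%:R)) \Po ('X + (p%:R)%:P).
  rewrite -comp_polyA; congr (_ \Po _).
  rewrite comp_polyD comp_polyM comp_polyX -!polyC_natr !comp_polyC natrD natrX.
  by ring.
rewrite uE comp_polyM rmorphXn /= -polyC_natr comp_polyC -mulrBr exprSr.
by apply: dvdr_mul; [exists 1; rewrite mulr1 | apply: dvdr_comp_shift].
Qed.

Lemma residue_dvd_iter_fdiff t f i : odd p ->
  residue_dvd t f -> residue_dvd (t + i %/ p ^ 2) (iter i fdiff f).
Proof.
move=> p_odd fP.
have -> : iter i fdiff f = iter (i %% p ^ 2) fdiff (iter (i %/ p ^ 2 * p ^ 2) fdiff f).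
  by rewrite -iterD addnC -divn_eq.
elim: (i %% _)%N => [|d IHd]; last exact: residue_dvd_fdiff.
elim: (i %/ _)%N => [|q IHq]; first by rewrite addn0.
by rewrite mulSn iterD addnS; apply: residue_dvd_iter_fdiffX2.
Qed.

(** If [p] divides [j], both powers of [p X + j] contain [p ^ N] because the exponents are at least
    [N]. Otherwise Fermat's little theorem makes the power [p - 1] congruent to 1 mod [p], and
    [dvdr_exp_sub1] lifts this to [p ^ N]. *)
Lemma residue_dvd_XnB m n N : (N <= m)%N -> (N <= n)%N ->
    m = n %[mod (p - 1) * p ^ (N - 1)] -> (0 < N)%N ->
  residue_dvd N ('X^m - 'X^n).
Proof.
wlog le_nm : m n / (n <= m)%N => [hwlog|] Nm Nn mn N_gt0.
  case/orP: (leq_total n m) => le; first exact: hwlog.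
  by move=> j; rewrite -opprB raddfN; apply/dvdrN/hwlog.
move=> j; rewrite comp_polyB !comp_Xn_poly.
have [/dvdnP[c ->]|pNj] := boolP (p %| j)%N.
  have pY (k : nat) : (N <= k)%N ->
      dvdr (p%:R ^+ N) ((p%:R * 'X + (c * p)%:R) ^+ k : {poly int}).
    move=> /subnKC <-; rewrite exprD mulrC; apply/dvdr_mull/dvdr_exp.
    by exists ('X + c%:R); rewrite natrM; ring.
  by apply: dvdrB; apply: pY.
have /dvdnP[u mnE] : ((p - 1) * p ^ (N - 1) %| m - n)%N.
  by rewrite -eqn_mod_dvd // mn.
rewrite -(subnK le_nm) exprD mnE [(u * _)%N]mulnC -[X in _ - X]mul1r -mulrBl mulrC.
apply: dvdr_mull; rewrite exprM -[X in _ - X](expr1n _ u).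
apply: dvdr_subXX; rewrite exprM -{1}(subnK N_gt0) addn1.
apply: dvdr_exp_sub1; set Y := _ * 'X + _.
have -> : Y ^+ (p - 1) - 1 = (Y ^+ (p - 1) - j%:R ^+ (p - 1)) + (j%:R ^+ (p - 1) - 1).
  by rewrite addrA subrK.
apply: dvdrD; first by apply: dvdr_subXX; exists 'X; rewrite /Y addrK.
have j_gt0 : (0 < j)%N by case: j pNj {Y} => //; rewrite dvdn0.
rewrite -natrX -[X in _ - X]/(1%:R) -natrB ?expn_gt0 ?j_gt0 //; apply: dvdr_natr.
rewrite -eqn_mod_dvd ?expn_gt0 ?j_gt0 // subn1 -totient_prime //.
by apply/eqP/Euler_exp_totient; rewrite coprime_sym prime_coprime.
Qed.

Lemma dvdr_iter_fdiff_XnB m n N i (b : nat) :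
    odd p -> (0 < N)%N -> (N <= m)%N -> (N <= n)%N ->
    m = n %[mod (p - 1) * p ^ (N - 1)] ->
  dvdr (p%:R ^+ (N + i %/ p ^ 2)) (iter i fdiff ('X^m - 'X^n)).[b%:R].
Proof.
move=> p_odd N_gt0 Nm Nn mn.
have [u uE] := residue_dvd_iter_fdiff i p_odd (residue_dvd_XnB Nm Nn mn N_gt0) b.
(* Setting [X = 0] in [p X + b] gives the value at [b]. *)
exists u.[0]; have := congr1 (horner^~ 0) uE.
by rewrite horner_comp -!polyC_natr -rmorphXn !hornerE.
Qed.

End PadicDifferences.

(** * p-integral rationals and the coefficients of Li *)

Section PIntegral.

Variable p : nat.
Hypothesis p_pr : prime p.

(** The localization of the integers at [p]; the fraction need not be reduced, which makes closure
    under sums and products immediate. *)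
Definition pint (x : rat) :=
  exists (z : int) (d : nat), ~~ (p %| d)%N /\ x * d%:R = z%:~R.

Lemma pint_int (z : int) : pint z%:~R.
Proof. by exists z, 1%N; rewrite mulr1 Euclid_dvd1. Qed.

Lemma pint_nat (n : nat) : pint n%:R.
Proof. exact: (pint_int n). Qed.

Lemma pintD x y : pint x -> pint y -> pint (x + y).
Proof.
move=> [u [c [pc xE]]] [v [d [pd yE]]]; exists (u * d%:Z + v * c%:Z), (c * d)%N.
split; first by rewrite Euclid_dvdM // negb_or pc.
by rewrite natrM intrD !intrM -xE -yE; ring.
Qed.

Lemma pintM x y : pint x -> pint y -> pint (x * y).
Proof.
move=> [u [c [pc xE]]] [v [d [pd yE]]]; exists (u * v), (c * d)%N.
split; first by rewrite Euclid_dvdM // negb_or pc.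
by rewrite natrM intrM -xE -yE; ring.
Qed.

Lemma pint_sum (I : Type) (s : seq I) (P : pred I) (F : I -> rat) :
  (forall i, P i -> pint (F i)) -> pint (\sum_(i <- s | P i) F i).
Proof. by move=> pF; apply: big_ind => //; [apply: (pint_int 0)|apply: pintD]. Qed.

Lemma pint_prod (I : Type) (s : seq I) (P : pred I) (F : I -> rat) :
  (forall i, P i -> pint (F i)) -> pint (\prod_(i <- s | P i) F i).
Proof. by move=> pF; apply: big_ind => //; [apply: (pint_int 1)|apply: pintM]. Qed.

Lemma pintX x n : pint x -> pint (x ^+ n).
Proof. by move=> px; elim: n => [|n]; [apply: (pint_int 1)|rewrite exprS; apply: pintM]. Qed.

Lemma pint_padic_integral x : pint x -> padic_integral p x.
Proof.
move=> [z [d [pd xE]]]; rewrite /padic_integral; case: eqP => //= /eqP x_neq0.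
have numE : numq x * d%:Z = z * denq x.
  apply: (@intr_inj rat); rewrite !intrM -xE numqE.
  by rewrite -pmulrn mulrAC.
have d_gt0 : (0 < d)%N by case: d pd {xE numE} => //; rewrite dvdn0.
have z_neq0 : z != 0.
  apply: contraNneq x_neq0 => z0; move: xE; rewrite z0 => /eqP.
  by rewrite mulf_eq0 pnatr_eq0 -[d == 0%N]negbK -lt0n d_gt0 orbF.
move/(congr1 (logn p \o absz)): numE => /=.
rewrite !abszM !lognM ?absz_gt0 ?numq_eq0 ?denq_neq0 -?lt0n //=.
have -> : logn p d = 0%N by rewrite lognE (negbTE pd) !andbF.
by rewrite /padic_val addn0 => ->; rewrite PoszD addrK.
Qed.

(** The [p]-part of [m] is at most [p ^ e], so only the part of [m] prime to [p] remains as
    denominator. *)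
Lemma pint_expn_div e m : (0 < m < p ^ e.+1)%N -> pint (p%:R ^+ e / m%:R).
Proof.
move=> /andP[m_gt0 m_lt]; have p_gt1 := prime_gt1 p_pr.
exists (p ^ (e - logn p m))%:Z, (m`_p^')%N; split.
  by rewrite -prime_coprime // (pnat_coprime (pnat_id p_pr)) ?part_pnat.
have le_me : (logn p m <= e)%N.
  rewrite -ltnS -(ltn_exp2l _ _ p_gt1); apply: leq_ltn_trans m_lt.
  by apply: dvdn_leq => //; apply: pfactor_dvdnn.
have := partnC p m_gt0; rewrite p_part; move: le_me; set v := logn p m => le_ve mE.
have m_neq0 : m%:R != 0 :> rat by rewrite pnatr_eq0 -lt0n.
apply: (mulIf m_neq0); rewrite mulrAC divfK //.
by rewrite -[in RHS]mE -pmulrn natrM !natrX mulrA -exprD subnK.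
Qed.

(** The power of [p ^ e] splits over the entries: each positive [k_i] receives enough to clear
    [m_i ^ k_i], and a negative [k_i] gives an integer. *)
Lemma pint_Li r (k : r.-tuple int) (e j : nat) : (j < p ^ e.+1)%N ->
  pint ((p%:R ^+ e) ^ wt (index_pos k) * Li k j).
Proof.
move=> j_lt; rewrite /Li mulr_sumr; apply: pint_sum => m /andP[m_path _].
have pe_neq0 : (p%:R ^+ e : rat) != 0 by rewrite expf_neq0 // pnatr_eq0 -lt0n prime_gt0.
have -> : (p%:R ^+ e : rat) ^ wt (index_pos k) =
    \prod_(i < r) (p%:R ^+ e) ^ Num.max (tnth k i) 0.
  rewrite /wt; under [in LHS]eq_bigr do rewrite tnth_mktuple.
  by apply: (big_morph (fun a : int => (p%:R ^+ e : rat) ^ a)) => // a b; rewrite expfzDr.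
rewrite -big_split /=; apply: pint_prod => i _.
have mi_gt0 : (0 < (tnth m i : nat))%N.
  move: m_path; rewrite (path_sortedE ltn_trans) => /andP[/allP m_gt0 _].
  by apply: m_gt0; apply/map_f/mem_tnth.
have mi_lt : (tnth m i < p ^ e.+1)%N by apply: leq_ltn_trans j_lt; rewrite -ltnS.
case: (tnth k i) => a.
  rewrite max_l // -!exprnP -exprVn -exprMn; apply/pintX/pint_expn_div.
  by rewrite mi_gt0.
by rewrite max_r // expr0z mul1r NegzE invr_expz opprK -exprnP; apply/pintX/pint_nat.
Qed.

End PIntegral.

(** * Exponential series and finite-difference formulas for B and C *)

Lemma fps_mul_expc c d : fps_mul (fps_expc c) (fps_expc d) =1 fps_expc (c + d).
Proof.
move=> n; rewrite /fps_expc addrC exprDn mulr_suml; apply: eq_bigr => i _.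
have i_le : (i <= n)%N by rewrite -ltnS.
have natr_neq0 a : (0 < a)%N -> (a%:R : rat) != 0 by rewrite pnatr_eq0 lt0n.
rewrite -(bin_fact i_le) !natrM -(mulr_natr (_ * _)).
have := natr_neq0 _ (fact_gt0 i); have := natr_neq0 _ (fact_gt0 (n - i)).
have : ('C(n, i)%:R : rat) != 0 by rewrite natr_neq0 // bin_gt0.
move: (i`!%:R : rat) ((n - i)`!%:R : rat) ('C(n, i)%:R : rat) => u v w w0 v0 u0.
by field; apply/and3P.
Qed.

Lemma fps_mulC f g : fps_mul f g =1 fps_mul g f.
Proof.
move=> n; rewrite /fps_mul (reindex_inj rev_ord_inj) /=; apply: eq_bigr => i _.
by rewrite subSS subKn 1?mulrC // -ltnS.
Qed.

Lemma fps_mul_subr f g h : fps_mul f (fps_sub g h) =1 fps_sub (fps_mul f g) (fps_mul f h).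
Proof. by move=> n; rewrite /fps_sub -sumrB; apply: eq_bigr => i _; rewrite mulrBr. Qed.

Lemma fps_mul_subl f g h : fps_mul (fps_sub f g) h =1 fps_sub (fps_mul f h) (fps_mul g h).
Proof. by move=> n; rewrite /fps_sub -sumrB; apply: eq_bigr => i _; rewrite mulrBl. Qed.

Lemma fps_mul1r f : fps_mul f fps_one =1 f.
Proof.
move=> n; rewrite /fps_mul big_ord_recr /= subnn mulr1 big1 ?add0r // => i _.
by rewrite /fps_one subn_eq0 leqNgt ltn_ord mulr0.
Qed.

(* The series e ^ (- b t) * (1 - e ^ (- t)) ^ j, see fps_pow_one_sub_expN. *)
Definition fdiff_egf (b j : nat) : fps :=
  fps_egf (fun n => (-1) ^+ (j + n) * (iter j fdiff 'X^n).[b%:R]%:~R).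

Lemma fdiff_egf0 b : fdiff_egf b 0 =1 fps_expc (- b%:R).
Proof.
move=> n; rewrite /fdiff_egf /fps_egf /fps_expc /= hornerXn rmorphXn /= rmorph_nat.
by rewrite -exprMn mulN1r.
Qed.

Lemma fdiff_egfS b j : fdiff_egf b j.+1 =1 fps_sub (fdiff_egf b j) (fdiff_egf b.+1 j).
Proof.
move=> n; rewrite /fdiff_egf /fps_egf /fps_sub iterS horner_fdiff natr1 intrB.
by rewrite addSn exprS; ring.
Qed.

Lemma fdiff_egf_mul_expc b b' j c : b'%:R = b%:R - c ->
  fps_mul (fdiff_egf b j) (fps_expc c) =1 fdiff_egf b' j.
Proof.
elim: j b b' => [|j IHj] b b' bE n.
  rewrite (eq_fps_mull _ (fdiff_egf0 b)) fps_mul_expc fdiff_egf0.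
  by rewrite bE opprB addrC.
rewrite (eq_fps_mull _ (fdiff_egfS b j)) fps_mul_subl fdiff_egfS /fps_sub.
by rewrite (IHj _ b') // (IHj _ b'.+1) // -natr1 bE -[b.+1%:R]natr1 addrAC.
Qed.

Lemma fdiff_egf_mul_one_sub_expN b j :
  fps_mul (fdiff_egf b j) one_sub_expN =1 fdiff_egf b j.+1.
Proof.
move=> n; rewrite fps_mul_subr fdiff_egfS /fps_sub fps_mul1r.
by rewrite (@fdiff_egf_mul_expc _ b.+1) // opprK natr1.
Qed.

Lemma fdiff_egf_mul_exp_sub_one b j :
  fps_mul (fdiff_egf b.+1 j) exp_sub_one =1 fdiff_egf b j.+1.
Proof.
move=> n; rewrite fps_mul_subr fdiff_egfS /fps_sub fps_mul1r.
by rewrite (@fdiff_egf_mul_expc _ b) // -natr1 addrK.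
Qed.

Lemma fdiff_egf_small b j n : (n < j)%N -> fdiff_egf b j n = 0.
Proof.
elim: j n => // j IHj n n_lt; rewrite -fdiff_egf_mul_one_sub_expN /fps_mul.
rewrite big_ord_recr /= subnn one_sub_expN0 mulr0 addr0 big1 // => i _.
by rewrite IHj ?mul0r // (leq_trans (ltn_ord i)) // -ltnS.
Qed.

Lemma fps_pow_one_sub_expN j : fps_pow one_sub_expN j =1 fdiff_egf 0 j.
Proof.
elim: j => [|j IHj] n.
  by rewrite fdiff_egf0 /fps_pow /= /fps_one /fps_expc oppr0 expr0n; case: n => // n; rewrite mul0r.
rewrite -fdiff_egf_mul_one_sub_expN -(eq_fps_mull _ IHj).
exact: fps_mulC.
Qed.

(** The hypothesis on [g] says that [(1 - e^(-t))^(j+1) / g] is [e^(-b t) (1 - e^(-t))^j]: for B,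
    [g = 1 - e^(-t)] and [b = 0]; for C, [g = e^t - 1] and [b = 1]. *)
Lemma fps_div_comp_one_sub_expN (a g : fps) (b : nat) :
    a 0%N = 0 -> g 0%N = 0 -> g 1%N != 0 ->
    (forall j, fps_mul (fdiff_egf b j) g =1 fdiff_egf 0 j.+1) ->
  fps_div (fps_comp a one_sub_expN) g
    =1 (fun n => \sum_(j < n.+1) a j.+1 * fdiff_egf b j n).
Proof.
move=> a0 g0 g1 gE n; apply/esym; move: n; apply: fps_div_uniq => // n.
transitivity (\sum_(i < n.+1) (\sum_(j < n.+1) a j.+1 * fdiff_egf b j i) * g (n - i)%N).
  apply: eq_bigr => i _; congr (_ * _).
  rewrite (big_ord_widen n.+1 (fun j => a j.+1 * fdiff_egf b j i)) //.
  rewrite big_mkcond /=; apply: eq_bigr => j _; case: ifP => // /negbT.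
  by rewrite -leqNgt => i_lt; rewrite fdiff_egf_small ?mulr0.
under eq_bigr do rewrite mulr_suml.
(* The index shift leaves an extra term [j = n] on the left; it vanishes because [g 0 = 0] and
   [fdiff_egf b n] has order at least [n]. *)
rewrite exchange_big /fps_comp big_ord_recr /= [RHS]big_ord_recl a0 mul0r add0r.
rewrite [X in _ + X]big1 ?addr0.
  apply: eq_bigr => j _; rewrite lift0 fps_pow_one_sub_expN -gE /fps_mul mulr_sumr.
  by apply: eq_bigr => i _; rewrite mulrA.
move=> i _; have := ltn_ord i; rewrite ltnS leq_eqVlt => /predU1P[->|i_lt].
  by rewrite subnn g0 mulr0.
by rewrite fdiff_egf_small ?mulr0 ?mul0r.
Qed.

Lemma factM_fdiff_egf b j n :
  n`!%:R * fdiff_egf b j n = (-1) ^+ (j + n) * (iter j fdiff 'X^n).[b%:R]%:~R.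
Proof. by rewrite /fdiff_egf mulrC divfK // pnatr_eq0 -lt0n fact_gt0. Qed.

(** Treats both families at once: [b = 0] gives B and [b = 1] gives C. *)
Definition Li_fdiff r (k : r.-tuple int) (b n : nat) : rat :=
  n`!%:R * \sum_(j < n.+1) Li k j.+1 * fdiff_egf b j n.

Lemma polyBernoulliBE r (k : r.-tuple int) n : (0 < r)%N ->
  polyBernoulliB k n = Li_fdiff k 0 n.
Proof.
move=> r_gt0; congr (_ * _); apply: fps_div_comp_one_sub_expN.
- exact: Li0.
- exact: one_sub_expN0.
- by rewrite one_sub_expN1 oner_eq0.
- by move=> j; apply: fdiff_egf_mul_one_sub_expN.
Qed.

Lemma polyBernoulliCE r (k : r.-tuple int) n : (0 < r)%N ->
  polyBernoulliC k n = Li_fdiff k 1 n.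
Proof.
move=> r_gt0; congr (_ * _); apply: fps_div_comp_one_sub_expN.
- exact: Li0.
- exact: exp_sub_one0.
- by rewrite exp_sub_one1 oner_eq0.
- by move=> j; apply: fdiff_egf_mul_exp_sub_one.
Qed.

Lemma Li_fdiff_widen r (k : r.-tuple int) b n K : (n < K)%N ->
  Li_fdiff k b n =
  \sum_(j < K) Li k j.+1 * ((-1) ^+ (j + n) * (iter j fdiff 'X^n).[b%:R]%:~R).
Proof.
move=> n_lt; rewrite /Li_fdiff (big_ord_widen K (fun j => Li k j.+1 * fdiff_egf b j n)) //.
rewrite big_mkcond mulr_sumr /=; apply: eq_bigr => j _; rewrite -factM_fdiff_egf.
case: ifP => [_|/negbT]; first by rewrite mulrCA.
by rewrite -leqNgt => n_lt_j; rewrite fdiff_egf_small ?mulr0.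
Qed.

(** * Balance of the powers of p, and the congruences *)

Lemma leq_muln_divn_expn2 p e w j : (w < p - 1)%N -> (p ^ e <= j.+1)%N ->
  (e * w <= 2 * w + j %/ p ^ 2)%N.
Proof.
move=> w_lt pe_le; have p_gt1 : (1 < p)%N by lia.
case: (leqP e 2) => [e_le|]; first by rewrite (leq_trans _ (leq_addr _ _)) // leq_mul2r e_le orbT.
move=> e_gt2; have [f eE] : exists f, e = (2 + f)%N by exists (e - 2)%N; lia.
rewrite {}eE {e e_gt2} in pe_le *; rewrite mulnDl leq_add2l leq_divRL ?expn_gt0 ?(ltnW p_gt1) //.
(* It yields [f * w * p ^ 2 < p ^ (2 + f) <= j.+1], hence [f * w <= j %/ p ^ 2]. *)
have bernoulli : (f * (p - 1) < p ^ f)%N.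
  elim: f {pe_le} => // f IHf; rewrite expnS mulSn.
  have : (0 < p ^ f)%N by rewrite expn_gt0 (ltnW p_gt1).
  by nia.
rewrite -ltnS; apply: leq_trans pe_le; rewrite expnD mulnC ltn_pmul2l ?expn_gt0 ?(ltnW p_gt1) //.
by apply: leq_ltn_trans bernoulli; rewrite leq_mul2l (ltnW w_lt) orbT.
Qed.

Lemma Li_fdiff_congr r (k : r.-tuple int) (p m n N b : nat) :
    prime p -> odd p -> (0 < N)%N -> (N <= m)%N -> (N <= n)%N ->
    wt (index_pos k) < p%:Z - 1 -> m = n %[mod (p - 1) * p ^ (N - 1)] ->
  padic_congr p N (p%:R ^ (2 * wt (index_pos k)) * Li_fdiff k b m)
                  (p%:R ^ (2 * wt (index_pos k)) * Li_fdiff k b n).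
Proof.
move=> p_pr p_odd N_gt0 Nm Nn wt_lt mn; apply: pint_padic_integral => //.
have p_gt1 := prime_gt1 p_pr.
have p_neq0 : (p%:R : rat) != 0 by rewrite pnatr_eq0 -lt0n ?prime_gt0.
have [w wE] : exists w : nat, wt (index_pos k) = w%:Z.
  have : 0 <= wt (index_pos k).
    by apply: sumr_ge0 => i _; rewrite tnth_mktuple le_max lexx orbT.
  by case: (wt _) => // w _; exists w.
have w_lt : (w < p - 1)%N by move: wt_lt; rewrite wE; lia.
(* The modulus is even because [p - 1] is, so the signs for [m] and [n] agree. *)
have odd_mn : odd m = odd n.
  have : m = n %[mod 2].
    have dvd2 : (2 %| (p - 1) * p ^ (N - 1))%N.
      by rewrite dvdn_mulr // dvdn2 oddB ?prime_gt0 // p_odd.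
    by rewrite -(modn_dvdm m dvd2) mn modn_dvdm.
  by rewrite !modn2; case: (odd m) (odd n) => [] [].
(* A common range allows the two sums to be subtracted termwise. *)
pose K := (maxn m n).+1.
rewrite (@Li_fdiff_widen _ _ _ m K) ?ltnS ?leq_maxl //.
rewrite (@Li_fdiff_widen _ _ _ n K) ?ltnS ?leq_maxr //.
rewrite -mulrBr -sumrB wE !mulr_sumr; apply: pint_sum => // j _.
rewrite -mulrBr -signr_odd -[X in _ - X * _]signr_odd !oddD odd_mn -mulrBr -intrB.
have [u] := dvdr_iter_fdiff_XnB p_pr j b p_odd N_gt0 Nm Nn mn.
rewrite iter_fdiffB hornerD hornerN => ->.
(* The largest [e] with [p ^ e <= j.+1], so that [(p ^ e) ^ w] clears the [p]-part of the
   denominator of [Li k j.+1]. *)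
pose e := trunc_log p j.+1.
have pe_le : (p ^ e <= j.+1)%N by apply: trunc_logP.
have [d dE] : exists d, (2 * w + j %/ p ^ 2 = e * w + d)%N.
  by exists (2 * w + j %/ p ^ 2 - e * w)%N; rewrite subnKC // leq_muln_divn_expn2.
have -> : p%:R ^- N * (p%:R ^ (2 * w%:Z) *
    (Li k j.+1 * ((-1) ^+ (odd j (+) odd n) * (p%:R ^+ (N + j %/ p ^ 2) * u)%:~R))) =
    ((p%:R ^+ e) ^ w%:Z * Li k j.+1) *
    (p%:R ^+ d * ((-1) ^+ (odd j (+) odd n) * u%:~R)).
  rewrite -!PoszM -!exprnP -exprM intrM rmorphXn /= rmorph_nat.
  transitivity (p%:R ^+ (e * w + d) * (Li k j.+1 * ((-1) ^+ (odd j (+) odd n) * u%:~R))).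
    by rewrite -dE !exprD; field; apply: expf_neq0.
  by rewrite exprD; ring.
apply: pintM => //; first by rewrite -wE; apply: pint_Li => //; apply: trunc_log_ltn.
apply: pintM => //; first exact/pintX/pint_nat.
by apply: pintM => //; [apply/pintX/(pint_int p_pr (-1))|apply: pint_int].
Qed.

Theorem theorem1p6 (r : nat) (k : r.-tuple int) (p m n N : nat)
    (hr : (1 <= r)%N) (hp : prime p) (hp2 : odd p)
    (hm : (0 < m)%N) (hn : (0 < n)%N) (hN : (0 < N)%N)
    (hmN : (N <= m)%N) (hnN : (N <= n)%N)
    (hwt : wt (index_pos k) < p%:Z - 1)
    (hmn : m = n %[mod (p - 1) * p ^ (N - 1)]) :
  padic_congr p N
    (p%:R ^ (2 * wt (index_pos k)) * polyBernoulliB k m)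
    (p%:R ^ (2 * wt (index_pos k)) * polyBernoulliB k n)
  /\
  padic_congr p N
    (p%:R ^ (2 * wt (index_pos k)) * polyBernoulliC k m)
    (p%:R ^ (2 * wt (index_pos k)) * polyBernoulliC k n).
Proof.
by rewrite !polyBernoulliBE // !polyBernoulliCE //; split; apply: Li_fdiff_congr.
Qed.
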